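(* Let $\pi$ be an irreducible cuspidal representation of $\mathrm{GL}_2(\mathbb F)$ with a non-trivial central character $\omega_\pi$. Then $$\gamma(\pi,\wedge^2,\psi)=q^{-\frac12}\sum_{a\in\mathbb F^*}\omega_\pi(a^{-1})\psi(a).$$
   Context: $\mathbb F$ is a finite field with $q$ elements and $\psi:\mathbb F\to\mathbb C^*$ is a non-trivial additive character. $N_2\le\mathrm{GL}_2(\mathbb F)$ is the upper triangular unipotent subgroup, with character $\psi(u)=\psi(u_{12})$. $\mathcal W(\pi,\psi)$ is the Whittaker model of $\pi$: the functions $g\mapsto\ell(\pi(g)v)$, $v\in V_\pi$, where $0\ne\ell\in\mathrm{Hom}_{N_2}(\pi,\psi)$; the group acts by right translation. $\tilde W(g)=W(w_2\,{}^tg^{-1})\in\mathcal W(\tilde\pi,\psi^{-1})$, where $w_2=\begin{pmatrix}&1\\1&\end{pmatrix}$ and $\tilde\pi$ is the contragredient. $\mathcal S(\mathbb F)$ is the space of functions $\mathbb F\to\mathbb C$ and $\mathcal F_\psi\phi(y)=q^{-1/2}\sum_{x\in\mathbb F}\phi(x)\psi(xy)$. The Jacquet–Shalika integral for $\mathrm{GL}_2$ (the case $m=1$ of the general definition for $\mathrm{GL}_{2m}$) is $$J_{\pi,\psi}(W,\phi)=\frac1{|\mathbb F^*|}\sum_{g\in\mathbb F^*}W\begin{pmatrix}g&\\&g\end{pmatrix}\phi(g),$$ and its dual is $\tilde J_{\pi,\psi}(W,\phi)=J_{\tilde\pi,\psi^{-1}}\left(\tilde\pi\begin{pmatrix}&1\\1&\end{pmatrix}\tilde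 W,\mathcal F_\psi\phi\right)$. When $\pi$ is irreducible cuspidal and admits no Shalika vector (a vector $0\ne v\in V_\pi$ with $\pi\begin{pmatrix}g&x\\&g\end{pmatrix}v=\psi(xg^{-1})v$ for all $g\in\mathbb F^*,x\in\mathbb F$), which holds in particular when $\omega_\pi$ is non-trivial, $\gamma(\pi,\wedge^2,\psi)\in\mathbb C^*$ is the unique non-zero constant (it exists) such that $\tilde J_{\pi,\psi}(W,\phi)=\gamma(\pi,\wedge^2,\psi)J_{\pi,\psi}(W,\phi)$ for all $W\in\mathcal W(\pi,\psi)$, $\phi\in\mathcal S(\mathbb F)$. *)

(* Defs.v *)
From HB Require Import structures.
From mathcomp Require Import all_boot all_order all_algebra all_fingroup.
From mathcomp Require Import mxrepresentation.
From mathcomp Require Import boolp classical_sets reals.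
From mathcomp Require Export complex.

Set Implicit Arguments.
Unset Strict Implicit.
Unset Printing Implicit Defensive.

Import GRing.Theory Num.Theory.
Local Open Scope ring_scope.

Section GL2.
Variable F : finFieldType.

(* The value 1 for singular A is never used: see mkGLK and the unitmx lemmas. *)
Definition mkGL (A : 'M[F]_2) : {'GL_2[F]} := insubd (1%g : {'GL_2[F]}) A.

Lemma mkGLK (A : 'M[F]_2) : A \in unitmx -> GLval (mkGL A) = A.
Proof. by move=> uA; rewrite /mkGL; apply: (insubdK (1%g : {'GL_2[F]})). Qed.

Definition scalarGL (a : {unit F}) : {'GL_2[F]} := mkGL (val a)%:M.

Lemma scalar_unitmx (a : {unit F}) : ((val a)%:M : 'M[F]_2) \in unitmx.
Proof. by rewrite unitmxE det_scalar unitrX // (valP a). Qed.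

Definition w2_mx : 'M[F]_2 := \matrix_(i, j) (i != j)%:R.

Lemma w2_unitmx : w2_mx \in unitmx.
Proof.
suff /mulmx1_unit[]: w2_mx *m w2_mx = 1%:M by [].
apply/matrixP=> i j; rewrite !mxE !big_ord_recl big_ord0 !mxE.
by case: i j => [[|[|i]] hi] [[|[|j]] hj] //=; rewrite !(mul0r, mul1r, addr0, add0r).
Qed.

Definition w2 : {'GL_2[F]} := mkGL w2_mx.

Definition trinvGL (g : {'GL_2[F]}) : {'GL_2[F]} := mkGL (invmx (GLval g))^T.

Lemma trinv_unitmx (g : {'GL_2[F]}) : (invmx (GLval g))^T \in unitmx.
Proof. by rewrite unitmx_tr unitmx_inv; apply: GL_unitmx. Qed.

Definition N2 : {set {'GL_2[F]}} :=
  [set u : {'GL_2[F]} | [&& GLval u 0 0 == 1, GLval u 1 0 == 0 & GLval u 1 1 == 1]].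

End GL2.

Arguments w2 {F}.

Section Gamma.
Variables (C : numClosedFieldType) (F : finFieldType).

Definition additive_character (psi : F -> C) : Prop :=
  psi 0 = 1 /\ forall x y, psi (x + y) = psi x * psi y.

Definition nontrivial_character (psi : F -> C) : Prop := exists x, psi x != 1.

Section Representation.
(* pi g acts on column vectors, v |-> pi g *m v, so that it is a left action;
   functionals on V_pi are then row vectors.  mx_irreducible is phrased with
   row spaces; mx_irreducible_colP below reads it on columns. *)
Variables (n : nat) (pi : mx_representation C 'GL_2[F] n).

Lemma mx_irreducible_colP : mx_irreducible pi <->
  (0 < n)%N /\ forall U : 'M[C]_n,
    (forall g, exists B : 'M[C]_n, pi g *m U = U *m B) ->
    U != 0 -> U \in unitmx.
Proof.
split=> [/mx_irrP[n_gt0 irr]|[n_gt0 irr]].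
  split=> // U stU U0; rewrite -row_free_unit -kermx_eq0.
  apply: contraNT U0 => K0.
  have /row_fullP[B BK]: row_full (kermx U).
    apply: irr K0; apply/mxmoduleP=> g _; apply/sub_kermxP.
    by have [B eB] := stU g; rewrite -mulmxA eB mulmxA mulmx_ker mul0mx.
  by rewrite -[U]mul1mx -BK -mulmxA mulmx_ker mulmx0.
apply/mx_irrP; split=> // U /mxmoduleP modU U0.
rewrite row_full_unit -unitmx_tr -row_free_unit -kermx_eq0.
apply: contraNT U0; rewrite -(inj_eq trmx_inj) trmx0 => K0.
have UK : U *m (kermx U^T)^T = 0.
  by apply: trmx_inj; rewrite trmx_mul trmxK trmx0 mulmx_ker.
have uK : (kermx U^T)^T \in unitmx.
  apply: irr K0 => g.
  have /submxP[D eD] := modU g (finset.in_setT g).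
  have /submxP[B eB] : ((pi g *m (kermx U^T)^T)^T <= kermx U^T)%MS.
    apply/sub_kermxP; rewrite -trmx_mul mulmxA eD -mulmxA UK mulmx0.
    exact: trmx0.
  by exists B^T; rewrite -trmx_mul -eB trmxK.
by rewrite -[U]mulmx1 -(mulmxV uK) mulmxA UK mul0mx.
Qed.

Definition cuspidal : Prop :=
  forall v : 'cV[C]_n, (forall u, u \in N2 F -> pi u *m v = v) -> v = 0.

Definition central_char (a : {unit F}) : C :=
  xget 0 [set c | pi (scalarGL a) = c%:M].

Definition whittaker_functional (psi : F -> C) (l : 'rV[C]_n) : Prop :=
  forall u, u \in N2 F -> l *m pi u = psi (GLval u 0 1) *: l.

Definition whittaker_model (psi : F -> C) : set ({'GL_2[F]} -> C) :=
  [set W | exists l : 'rV[C]_n, exists v : 'cV[C]_n,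
     [/\ l != 0, whittaker_functional psi l
       & forall g, W g = (l *m (pi g *m v)) 0 0]].

End Representation.

Definition fourier (psi : F -> C) (phi : F -> C) (y : F) : C :=
  (sqrtC #|F|%:R)^-1 * \sum_(x : F) phi x * psi (x * y).

Definition right_translate (h : {'GL_2[F]}) (W : {'GL_2[F]} -> C) :=
  fun g => W (g * h)%g.

Definition dual_whittaker (W : {'GL_2[F]} -> C) : {'GL_2[F]} -> C :=
  fun g => W (w2 * trinvGL g)%g.

(* For GL_2 the integral depends on the representation and on psi only through
   W, so the same formula serves (pi, psi) and (contragredient, psi^-1). *)
Definition JS (W : {'GL_2[F]} -> C) (phi : F -> C) : C :=
  #|{: {unit F}}|%:R^-1 * \sum_(g : {unit F}) W (scalarGL g) * phi (val g).

Definition JS_dual (psi : F -> C) (W : {'GL_2[F]} -> C) (phi : F -> C) : C :=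
  JS (right_translate w2 (dual_whittaker W)) (fourier psi phi).

Definition gamma_equation n (pi : mx_representation C 'GL_2[F] n)
    (psi : F -> C) (c : C) : Prop :=
  c != 0 /\ forall W phi, whittaker_model pi psi W ->
    JS_dual psi W phi = c * JS W phi.

(* The default value 0 is returned if there is no such constant, or several. *)
Definition gamma_wedge2 n (pi : mx_representation C 'GL_2[F] n)
    (psi : F -> C) : C :=
  xget 0 [set c | unique (gamma_equation pi psi) c].

End Gamma.

(* Main.v *)
Require Import Defs.
From HB Require Import structures.
From mathcomp Require Import all_boot all_order all_algebra all_fingroup.
From mathcomp Require Import mxrepresentation spectral classical_sets.
From mathcomp Require Import reals complex.

Set Implicit Arguments.
Unset Strict Implicit.
Unset Printing Implicit Defensive.

Import GRing.Theory Num.Theory.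
Local Open Scope ring_scope.

(** The functional equation for GL_2 reduces to the one for GL_1. The torus of
    the Jacquet-Shalika integral is the centre of GL_2, which acts by
    [central_char], written om here, so that a Whittaker function satisfies
    [W (scalarGL a) = om a * W 1]. Hence the integral equals, up to
    normalisation, [W 1] times the Mellin transform of phi against om. On the
    dual side the two Weyl elements cancel, and W is evaluated at the inverse
    scalar, so that the dual integral is, with the same normalisation, [W 1]
    times the Mellin transform of the Fourier transform of phi against om^-1.

    The theorem is therefore the functional equation for the characters of
    GL_1 ([mellin_fourier]): the Fourier transform of the function om^-1,
    extended by zero, is a Gauss sum times om. It holds for every phi, including
    phi with [phi 0 != 0], because om is non-trivial and its values sum to zero.

    For the constant to be the gamma factor it must also be non-zero and unique.
    If the Gauss sum vanished, the Fourier transform of om^-1 would vanish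
    identically, contradicting Fourier inversion ([gauss_sum_neq0]). Uniqueness
    needs a single W and phi with non-zero integral; taking phi the indicator of
    1 this reduces to a Whittaker function with [W 1 != 0], hence to a non-zero
    Whittaker functional ([whittaker_functional_exists]). Such a functional is
    found by decomposing the restriction to N_2 into characters: cuspidality
    excludes the trivial one, and the diagonal torus permutes the others
    transitively. *)

(** * Sums of characters *)

Lemma sum_nontrivial_morph (A : idomainType) (gT : finGroupType) (f : gT -> A) :
  {morph f : x y / (x * y)%g >-> x * y} -> (exists x, f x != 1) ->
  \sum_x f x = 0.
Proof.
move=> fM [x0 fx0]; have : (f x0 - 1) * \sum_x f x = 0.
  rewrite mulrBl mul1r [X in _ - X](reindex_inj (mulgI x0)) mulr_sumr -sumrB.
  by rewrite big1 // => x _; rewrite fM subrr.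
by move/eqP; rewrite mulf_eq0 subr_eq0 (negPf fx0) => /eqP.
Qed.

Lemma sum_units (A : nmodType) (F : finFieldType) (f : F -> A) :
  f 0 = 0 -> \sum_x f x = \sum_(a : {unit F}) f (val a).
Proof.
move=> f0; rewrite (bigD1 0) //= f0 add0r.
rewrite (reindex_onto (fun a : {unit F} => val a)
                      (insubd (1%g : {unit F}))) /=; last first.
  by move=> x x0; rewrite insubdK // unfold_in /= unitfE.
by apply: eq_bigl => a; rewrite valKd eqxx andbT -unitfE (valP a).
Qed.

Section Characters.
Variables (C : numClosedFieldType) (F : finFieldType) (psi : F -> C).
Hypothesis psi_add : additive_character psi.
Hypothesis psi_nt : nontrivial_character psi.

Lemma character_orthogonality (c : F) :
  \sum_x psi (c * x) = #|F|%:R *+ (c == 0).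
Proof.
have [psi0 psiD] := psi_add; have [->|c0] := eqVneq c 0.
  under eq_bigr do rewrite mul0r psi0.
  by rewrite sumr_const.
rewrite mulr0n; apply: (@sum_nontrivial_morph C F) => [x y|].
  by rewrite /= -psiD -mulrDr.
by have [x psix] := psi_nt; exists (c^-1 * x); rewrite mulVKf.
Qed.

Variable chi : {unit F} -> C.
Hypothesis chi1 : chi 1%g = 1.
Hypothesis chiM : {morph chi : a b / (a * b)%g >-> a * b}.

Definition gauss_sum : C := \sum_(a : {unit F}) chi (a^-1)%g * psi (val a).

Lemma gauss_twist (b : {unit F}) :
  \sum_(a : {unit F}) chi (a^-1)%g * psi (val b * val a) = chi b * gauss_sum.
Proof.
rewrite /gauss_sum [in RHS](reindex_inj (mulgI b)) mulr_sumr.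
apply: eq_bigr => a _; rewrite invMg chiM mulrA mulrCA -chiM mulgV chi1 mulr1.
by rewrite FinRing.val_unitM.
Qed.

Hypothesis chi_nt : exists a, chi a != 1.

Lemma sum_inv_character : \sum_(a : {unit F}) chi (a^-1)%g = 0.
Proof.
rewrite (reindex_inj invg_inj) /=; under eq_bigr do rewrite invgK.
exact: sum_nontrivial_morph.
Qed.

(** Up to the factor [(sqrtC q)^-1], the left-hand side is the Fourier transform
    of the inverse of chi extended by 0 to F. At units the formula is a change
    of variable; at 0 the sum vanishes because chi is non-trivial. *)
Lemma fourier_inv_character (x : F) :
  \sum_(a : {unit F}) chi (a^-1)%g * psi (x * val a) =
    if insub x is Some b then chi b * gauss_sum else 0.
Proof.
have [psi0 _] := psi_add; case: insubP => [b _ <-|]; first exact: gauss_twist.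
rewrite unitfE negbK => /eqP->.
by under eq_bigr do rewrite mul0r psi0 mulr1; exact: sum_inv_character.
Qed.

(** The functional equation of the zeta integrals of GL_1: exchange the two sums
    and use [fourier_inv_character]. *)
Lemma mellin_fourier (phi : F -> C) :
  \sum_(a : {unit F}) chi (a^-1)%g * fourier psi phi (val a) =
    (sqrtC #|F|%:R)^-1 * gauss_sum * \sum_(a : {unit F}) chi a * phi (val a).
Proof.
rewrite -mulrA; under eq_bigr do rewrite mulrCA.
rewrite -mulr_sumr; congr (_ * _).
under eq_bigr do rewrite mulr_sumr.
rewrite exchange_big /=.
under eq_bigr => x _ do under eq_bigr do rewrite mulrCA.
under eq_bigr => x _ do rewrite -mulr_sumr fourier_inv_character.
rewrite sum_units /=; last by case: insubP => [b|]; rewrite ?unitr0 ?mulr0.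
rewrite mulr_sumr; apply: eq_bigr => b _.
by rewrite valK mulrC mulrAC mulrC.
Qed.

(** Fourier inversion at 1 recovers [q * chi 1], that is q, from the Fourier
    transform of the inverse of chi, which would be zero if the Gauss sum
    were. *)
Lemma gauss_sum_neq0 : gauss_sum != 0.
Proof.
have [psi0 psiD] := psi_add.
have : \sum_x psi (- x) * \sum_(a : {unit F}) chi (a^-1)%g * psi (x * val a)
    = #|F|%:R.
  under eq_bigr do rewrite mulr_sumr.
  rewrite exchange_big (bigD1 1%g) //= [X in _ + X]big1 => [|a a1]; last first.
    have a10 : (val a - 1 == 0) = false.
      rewrite subr_eq0; apply: negbTE; apply: contra a1 => /eqP e.
      exact/eqP/val_inj.
    have := character_orthogonality (val a - 1); rewrite a10 mulr0n => E.
    rewrite -[RHS](mulr0 (chi (a^-1)%g)) -[in RHS]E mulr_sumr.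
    apply: eq_bigr => x _; rewrite mulrCA -psiD; congr (_ * psi _).
    by rewrite mulrBl mul1r addrC mulrC.
  rewrite invg1 chi1 addr0.
  under eq_bigr do rewrite mul1r mulr1 -psiD addNr psi0.
  by rewrite sumr_const.
apply: contra_eq_neq => G0.
rewrite big1 => [|x _]; first
  by rewrite eq_sym pnatr_eq0 -lt0n; apply/card_gt0P; exists 0.
by rewrite fourier_inv_character G0; case: insub => [b|]; rewrite ?mulr0.
Qed.

End Characters.

(** * Elements of GL_2 *)

Section Matrices.
Variable F : finFieldType.

Lemma GLval_inj : injective (fun g : {'GL_2[F]} => GLval g).
Proof. exact: val_inj. Qed.

Lemma scalarGLE (a : {unit F}) : GLval (scalarGL a) = (val a)%:M.
Proof. exact/mkGLK/scalar_unitmx. Qed.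

Lemma scalarGLM : {morph @scalarGL F : a b / (a * b)%g}.
Proof.
move=> a b; apply: GLval_inj; rewrite scalarGLE GL_MxE !scalarGLE.
by rewrite -scalar_mxM.
Qed.

Lemma scalarGL1 : scalarGL (1%g : {unit F}) = 1%g.
Proof. by apply: GLval_inj; rewrite scalarGLE. Qed.

Lemma scalarGL_central (a : {unit F}) (g : {'GL_2[F]}) :
  commute (scalarGL a) g.
Proof. by apply: GLval_inj; rewrite !GL_MxE scalarGLE scalar_mxC. Qed.

Definition upperGL (x : F) : {'GL_2[F]} := mkGL (1%:M + x *: delta_mx 0 1).

Lemma upperGLE x : GLval (upperGL x) = 1%:M + x *: delta_mx 0 1.
Proof.
apply: mkGLK; suff /mulmx1_unit[]:
    (1%:M + x *: delta_mx 0 1) *m (1%:M - x *: delta_mx 0 1 : 'M[F]_2) = 1%:M.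
  by [].
rewrite mulmxBr mulmx1 mulmxDl mul1mx -scalemxAl -scalemxAr mul_delta_mx_0 //.
by rewrite !scaler0 addr0 addrK.
Qed.

Lemma upperGLD : {morph upperGL : x y / x + y >-> (x * y)%g}.
Proof.
move=> x y; apply: GLval_inj; rewrite upperGLE GL_MxE !upperGLE.
rewrite mulmxDr mulmx1 mulmxDl mul1mx -scalemxAl -scalemxAr mul_delta_mx_0 //.
by rewrite !scaler0 addr0 scalerDl addrA.
Qed.

Lemma upperGL0 : upperGL 0 = 1%g.
Proof. by apply: GLval_inj; rewrite upperGLE scale0r addr0. Qed.

Lemma N2E u : u \in N2 F -> u = upperGL (GLval u 0 1).
Proof.
rewrite inE => /and3P[/eqP u00 /eqP u10 /eqP u11].
apply: GLval_inj; rewrite upperGLE; apply/matrixP=> i j; rewrite !mxE.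
have o2 (k : 'I_2) : k = 0 \/ k = 1.
  by case: k => [[|[|k]] hk] //; [left|right]; apply: val_inj.
by case: (o2 i) => ->; case: (o2 j) => ->;
   rewrite ?u00 ?u10 ?u11 /= ?mulr1 ?mulr0 ?addr0 ?add0r.
Qed.

Definition diagGL (t : {unit F}) : {'GL_2[F]} :=
  mkGL (diag_mx (\row_j if j == 0 then val t else 1)).

Lemma diagGLE t :
  GLval (diagGL t) = diag_mx (\row_j if j == 0 then val t else 1).
Proof.
apply: mkGLK; rewrite unitmxE det_diag big_ord_recl big_ord1 !mxE /= mulr1.
exact: (valP t).
Qed.

(** Conjugation by the torus rescales N_2, and so permutes its non-trivial
    characters. *)
Lemma diagGL_upperGL t y :
  (diagGL t * upperGL y)%g = (upperGL (val t * y)%R * diagGL t)%g.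
Proof.
apply: GLval_inj; rewrite !GL_MxE diagGLE !upperGLE.
rewrite mulmxDr mulmxDl mulmx1 mul1mx; congr (_ + _).
rewrite mul_diag_mx mul_mx_diag; apply/matrixP=> i j; rewrite !mxE.
have [->|_] := eqVneq j 1; last by rewrite andbF !mulr0 mul0r.
by case: (i == 0); rewrite /= ?mulr1 ?mulr0 ?mul0r.
Qed.

(** The argument at which W is evaluated in the dual integral: w_2 is symmetric
    and an involution, so its two occurrences cancel. *)
Lemma w2_dual_scalarGL (a : {unit F}) :
  (w2 * trinvGL (scalarGL a * w2))%g = scalarGL (a^-1)%g.
Proof.
have w2E : GLval (@w2 F) = w2_mx F by apply/mkGLK/w2_unitmx.
have w2T : (w2_mx F)^T = w2_mx F by apply/matrixP=> i j; rewrite !mxE eq_sym.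
have trE g : GLval (trinvGL g) = (GLval (g^-1)%g)^T.
  by rewrite mkGLK ?trinv_unitmx // GL_VxE.
apply: GLval_inj; rewrite GL_MxE trE invMg GL_MxE trmx_mul.
have -> : (scalarGL a)^-1%g = scalarGL a^-1%g.
  by apply: (mulgI (scalarGL a)); rewrite mulgV -scalarGLM mulgV scalarGL1.
rewrite scalarGLE tr_scalar_mx mulmxA scalar_mxC -mulmxA GL_VxE w2E.
by rewrite trmx_inv w2T mulmxV ?w2_unitmx ?mulmx1 -?scalarGLE.
Qed.

End Matrices.

(** * Central characters and Whittaker functionals *)

Section Whittaker.
Variables (C : numClosedFieldType) (F : finFieldType).
Variables (n : nat) (pi : mx_representation C 'GL_2[F] n).

Lemma piM : {morph pi : g h / (g * h)%g >-> g *m h}.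
Proof. by move=> g h; rewrite repr_mxM // finset.in_setT. Qed.

Section CentralCharacter.
Hypothesis pi_irr : mx_irreducible pi.

Lemma irr_degree_gt0 : (0 < n)%N.
Proof. by case/mx_irrP: pi_irr. Qed.

(** Schur's lemma: an eigenvalue c exists over C, and the central operator minus
    c is then a singular intertwiner, hence zero. *)
Lemma central_charP (a : {unit F}) :
  pi (scalarGL a) = (central_char pi a)%:M.
Proof.
rewrite /central_char; set P : classical_sets.set C := (X in xget _ X).
apply: (@xgetPex _ 0 P); rewrite /P /mkset /=.
have [c] := eigenvalue_closed (pi (scalarGL a)) irr_degree_gt0.
move=> /eigenvalueP[v vc v0]; exists c; apply/eqP; rewrite -subr_eq0.
have cent : centgmx pi (pi (scalarGL a) - c%:M).
  apply/centgmxP=> g _; rewrite mulmxBl mulmxBr scalar_mxC -!piM.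
  by rewrite scalarGL_central.
apply: contraNT v0 => /(mx_Schur pi_irr cent) u.
by rewrite -(mulmxK u v) mulmxBr vc mul_mx_scalar subrr mul0mx.
Qed.

Lemma central_char_eq a c : pi (scalarGL a) = c%:M -> central_char pi a = c.
Proof.
pose i := Ordinal irr_degree_gt0; rewrite central_charP.
by move=> /(congr1 (fun A : 'M_n => A i i)); rewrite !mxE eqxx.
Qed.

Lemma central_char1 : central_char pi 1%g = 1.
Proof. by apply: central_char_eq; rewrite scalarGL1 repr_mx1. Qed.

Lemma central_charM : {morph central_char pi : a b / (a * b)%g >-> a * b}.
Proof.
move=> a b; apply: central_char_eq.
by rewrite scalarGLM piM !central_charP -scalar_mxM.
Qed.

Lemma whittaker_scalarGL psi W (a : {unit F}) : whittaker_model pi psi W ->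
  W (scalarGL a) = central_char pi a * W 1%g.
Proof.
move=> [l [v [_ _ WE]]]; rewrite !WE central_charP repr_mx1 mul1mx.
by rewrite mul_scalar_mx -scalemxAr mxE.
Qed.

Lemma JS_whittaker psi W phi : whittaker_model pi psi W ->
  JS W phi = #|{: {unit F}}|%:R^-1 *
    (W 1%g * \sum_(a : {unit F}) central_char pi a * phi (val a)).
Proof.
move=> WW; rewrite /JS; congr (_ * _); rewrite mulr_sumr; apply: eq_bigr => a _.
by rewrite (whittaker_scalarGL a WW) -mulrA mulrCA.
Qed.

Lemma JS_dual_whittaker psi W phi : whittaker_model pi psi W ->
  JS_dual psi W phi = #|{: {unit F}}|%:R^-1 *
    (W 1%g * \sum_(a : {unit F})
               central_char pi (a^-1)%g * fourier psi phi (val a)).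
Proof.
move=> WW; rewrite /JS_dual /JS; congr (_ * _); rewrite mulr_sumr.
apply: eq_bigr => a _; rewrite /right_translate /dual_whittaker.
by rewrite w2_dual_scalarGL (whittaker_scalarGL _ WW) -mulrA mulrCA.
Qed.

End CentralCharacter.

Variable psi : F -> C.
Hypothesis psi_add : additive_character psi.
Hypothesis psi_nt : nontrivial_character psi.

(** The action of q times the idempotent of C[N_2] attached to the character
    [fun x => psi (c * x)]. *)
Definition isotypic_op (c : F) : 'M[C]_n :=
  \sum_x psi (- (c * x)) *: pi (upperGL x).

Lemma isotypic_opMr c y :
  isotypic_op c *m pi (upperGL y) = psi (c * y) *: isotypic_op c.
Proof.
have [_ psiD] := psi_add.
rewrite /isotypic_op mulmx_suml scaler_sumr [RHS](reindex_inj (addIr y)).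
apply: eq_bigr => x _; rewrite -scalemxAl -piM -upperGLD scalerA -psiD.
by rewrite mulrDr opprD addrCA subrr addr0.
Qed.

Lemma sum_isotypic_op : \sum_c isotypic_op c = #|F|%:R%:M.
Proof.
rewrite exchange_big (bigD1 0) //= [X in _ + X]big1 => [|x x0].
  under eq_bigr do rewrite mulr0 oppr0 psi_add.1 scale1r upperGL0 repr_mx1.
  by rewrite addr0 sumr_const [RHS]raddfMn.
rewrite -scaler_suml.
under eq_bigr do rewrite -mulrN mulrC.
by rewrite character_orthogonality // oppr_eq0 (negPf x0) mulr0n scale0r.
Qed.

(** The columns of this matrix are fixed by N_2. *)
Lemma cuspidal_isotypic_op0 : cuspidal pi -> isotypic_op 0 = 0.
Proof.
move=> cusp; apply/matrixP=> i j; rewrite mxE.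
have E : isotypic_op 0 = \sum_x pi (upperGL x).
  by apply: eq_bigr => x _; rewrite mul0r oppr0 psi_add.1 scale1r.
suff /matrixP/(_ i 0) : col j (isotypic_op 0) = 0 by rewrite !mxE.
apply: cusp => u /N2E->; rewrite !colE mulmxA E; congr (_ *m _).
rewrite mulmx_sumr [RHS](reindex_inj (addrI (GLval u 0 1))).
by apply: eq_bigr => x _; rewrite upperGLD piM.
Qed.

(** The operators [isotypic_op c] sum to q, so one of them is non-zero, and by
    cuspidality c is non-zero. A non-zero row of it transforms under N_2 by
    [fun x => psi (c * x)], and translating it by a torus element turns this
    character into psi. *)
Lemma whittaker_functional_exists : (0 < n)%N -> cuspidal pi ->
  exists2 l, l != 0 & whittaker_functional pi psi l.
Proof.
move=> n_gt0 cusp.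
have [c Pc] : exists c, isotypic_op c != 0.
  apply/existsP; apply: contraT; rewrite negb_exists => /forallP P0.
  have /matrixP/(_ (Ordinal n_gt0) (Ordinal n_gt0)) := sum_isotypic_op.
  rewrite big1 => [|c _]; last by apply/eqP; rewrite -[_ == _]negbK P0.
  rewrite !mxE eqxx mulr1n => /esym/eqP; rewrite pnatr_eq0 => /eqP/card0_eq.
  by move/(_ 0).
have c0 : c != 0.
  by apply: contra_neq Pc => ->; exact: cuspidal_isotypic_op0.
have [i li] : exists i, row i (isotypic_op c) != 0.
  apply/existsP; apply: contraT; rewrite negb_exists => /forallP r0.
  case/eqP: Pc; apply/row_matrixP=> i; rewrite row0; apply/eqP.
  by rewrite -[_ == _]negbK r0.
have uc : c \is a GRing.unit by rewrite unitfE.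
(* Translating by the torus element with entry t multiplies the parameter of
   the character by t. *)
pose t : {unit F} := (Sub c uc : {unit F})^-1%g.
exists (row i (isotypic_op c) *m pi (diagGL t)).
  apply: contra li => /eqP l0.
  have uD := repr_mx_unit pi (finset.in_setT (diagGL t)).
  by rewrite -(mulmxK uD (row i _)) l0 mul0mx.
move=> u /N2E->; set y := GLval u 0 1; rewrite upperGLE.
rewrite -mulmxA -piM diagGL_upperGL piM mulmxA -row_mul isotypic_opMr.
rewrite [val t]/= mulVKf // !mxE /= mulr1 add0r linearZ /=.
by rewrite -scalemxAl.
Qed.

End Whittaker.

(** * The gamma factor *)

Theorem theorem2p37 (R : realType) (F : finFieldType) (psi : F -> R[i])
    (n : nat) (pi : mx_representation R[i] 'GL_2[F] n) :
  additive_character psi -> nontrivial_character psi ->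
  mx_irreducible pi -> cuspidal pi ->
  (exists a : {unit F}, central_char pi a != 1) ->
  gamma_wedge2 pi psi =
    (sqrtC #|F|%:R)^-1 *
      \sum_(a : {unit F}) central_char pi (a^-1)%g * psi (val a).
Proof.
move=> psi_add psi_nt pi_irr pi_cusp om_nt.
have om1 := central_char1 pi_irr; have omM := central_charM pi_irr.
rewrite -/(gauss_sum psi (central_char pi)).
set c := _ * _.
have JSdE W phi : whittaker_model pi psi W -> JS_dual psi W phi = c * JS W phi.
  move=> WW; rewrite (JS_dual_whittaker pi_irr _ WW) (JS_whittaker pi_irr _ WW).
  by rewrite (mellin_fourier psi_add om1 omM om_nt) -/c [in RHS]mulrCA
     [c * (W _ * _)]mulrCA.
have c0 : c != 0.
  rewrite mulf_neq0 ?invr_eq0 ?sqrtC_eq0 ?pnatr_eq0 -?lt0n ?gauss_sum_neq0 //.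
  by apply/card_gt0P; exists 0.
have uniq_c : unique (gamma_equation pi psi) c.
  split=> [|c' [_ c'E]]; first by split.
  have [l l0 lW] := whittaker_functional_exists psi_add psi_nt
    (irr_degree_gt0 pi_irr) pi_cusp.
  have [j lj] : exists j, l 0 j != 0 by exact/rV0Pn.
  pose v : 'cV[R[i]]_n := delta_mx j 0.
  pose W (g : {'GL_2[F]}) : R[i] := (l *m (pi g *m v)) 0 0.
  have WW : whittaker_model pi psi W by exists l, v.
  have W1 : W 1%g = l 0 j by rewrite /W repr_mx1 mul1mx -colE mxE.
  (* The indicator of 1 isolates the term W 1 of the integral. *)
  pose phi (x : F) : R[i] := (x == 1)%:R.
  have J0 : JS W phi != 0.
    rewrite (JS_whittaker pi_irr _ WW) (bigD1 1%g) //= big1 => [|a a1].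
      rewrite om1 /phi eqxx !mulr1 addr0 W1.
      apply: mulf_neq0; last by rewrite mulr1.
      rewrite invr_eq0 pnatr_eq0 -lt0n.
      by apply/card_gt0P; exists 1%g.
    rewrite /phi; case: eqP => [e|_]; rewrite ?mulr0 //.
    by case/eqP: a1; apply: val_inj.
  by apply: (mulIf J0); rewrite -JSdE // -c'E.
have [gamma_eq _] : unique (gamma_equation pi psi) (gamma_wedge2 pi psi).
  exact: (@xgetPex _ 0 (fun c => unique (gamma_equation pi psi) c)
                   (ex_intro _ c uniq_c)).
exact/esym/uniq_c.2.
Qed.
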